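(* Let $m>1$ be a squarefree integer, $\mathbb{K}=\mathbb{Q}(\sqrt{m})\subset\mathbb{R}$ with ring of integers $\mathcal{O}_{\mathbb{K}}$, and $\Gamma_{\mathbb{K}}=SL_2(\mathcal{O}_{\mathbb{K}})$. Then the normalizer \[ \mathcal{N}_{\mathbb{K}}=\{M\in SL_2(\mathbb{R});\; M^{-1}\Gamma_{\mathbb{K}}M=\Gamma_{\mathbb{K}}\} \] is equal to \[ \left\{\tfrac{1}{\sqrt{\det L}}\,L;\; L\in\mathcal{O}_{\mathbb{K}}^{2\times 2},\ \det L>0,\ \mathcal{I}(L)^2=\mathcal{O}_{\mathbb{K}}\det L\right\}. \]
   Context: $\mathbb{K}$ is regarded as a subfield of $\mathbb{R}$ via the positive square root $\sqrt{m}$. For a nonzero matrix $L\in\mathbb{K}^{2\times 2}$, $\mathcal{I}(L)$ denotes the (fractional) ideal of $\mathcal{O}_{\mathbb{K}}$ generated by the entries of $L$. *)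

(* Defs.v *)
From mathcomp Require Import all_boot all_order all_algebra.
From mathcomp Require Import classical_sets reals.

Set Implicit Arguments.
Unset Strict Implicit.
Unset Printing Implicit Defensive.

Import Order.TTheory GRing.Theory Num.Theory.
Local Open Scope classical_set_scope.
Local Open Scope ring_scope.

Definition squarefree (m : nat) : Prop :=
  forall d : nat, (d ^ 2 %| m)%N -> d = 1%N.

Definition quadratic_field (R : realType) (m : nat) : set R :=
  [set x | exists a b : rat, x = ratr a + ratr b * Num.sqrt m%:R].
Arguments quadratic_field : clear implicits.

Definition ring_of_integers (R : realType) (m : nat) : set R :=
  quadratic_field R m `&` [set x | integralOver (intr : int -> R) x].
Arguments ring_of_integers : clear implicits.

Definition matrices_over (R : realType) (A : set R) : set 'M[R]_2 :=
  [set L | forall i j, A (L i j)].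

Definition SL2 (R : realType) (A : set R) : set 'M[R]_2 :=
  [set M | matrices_over A M /\ \det M = 1].

Definition normalizer (R : realType) (G : set 'M[R]_2) : set 'M[R]_2 :=
  [set M | SL2 setT M /\ [set invmx M *m g *m M | g in G] = G].

(* Fractional ideals are represented by their carriers, as subsets of R;
   [ideal_span O A] is the O-submodule of R generated by A. *)
Definition ideal_span (R : realType) (O A : set R) : set R :=
  [set x | exists (n : nat) (c a : 'I_n -> R),
      [/\ forall i, O (c i), forall i, A (a i) & x = \sum_(i < n) c i * a i]].

Definition ideal_mul (R : realType) (O I J : set R) : set R :=
  ideal_span O [set x * y | x in I & y in J].

Definition principal_ideal (R : realType) (O : set R) (d : R) : set R :=
  [set c * d | c in O].

Definition entry_ideal (R : realType) (O : set R) (L : 'M[R]_2) : set R :=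
  ideal_span O [set x | exists i j, x = L i j].

(* Main.v *)
(* Every matrix unit is an integral combination of elements of [Γ] = SL2(O), so [M] normalizes [Γ]
   iff conjugation by [M] preserves all matrices over [O].  The entries of
   [M^-1 E_ij M] are, up to sign, the products of two entries of [M]; hence [M]
   normalizes [Γ] iff all these products lie in [O].  If so, [L = |p| M] is the
   required integral matrix for any entry [p != 0] of [M]. *)
Require Import Defs.
From mathcomp Require Import all_boot all_order all_algebra.
From mathcomp Require Import classical_sets reals.
From mathcomp Require Import ring.

Import Order.TTheory GRing.Theory Num.Theory.
Local Open Scope classical_set_scope.
Local Open Scope ring_scope.

(** * Subrings of the reals, given as sets so that [ring_of_integers] is an instance, and matrices
    over them *)

Definition is_subring {R : realType} (O : set R) : Prop :=
  [/\ O 1, forall x y, O x -> O y -> O (x - y)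
    & forall x y, O x -> O y -> O (x * y)].

Section Subring.
Context {R : realType} {O : set R} (Oring : is_subring O).

Let O1 : O 1. Proof. by case: Oring. Qed.
Let OB x y : O x -> O y -> O (x - y). Proof. by case: Oring => _ + _; apply. Qed.
Let OM x y : O x -> O y -> O (x * y). Proof. by case: Oring => _ _; apply. Qed.

Lemma subring0 : O 0.
Proof. by rewrite -(subrr 1); exact: OB. Qed.

Lemma subringN x : O x -> O (- x).
Proof. by move=> Ox; rewrite -sub0r; exact: OB subring0 Ox. Qed.

Lemma subringD x y : O x -> O y -> O (x + y).
Proof. by move=> Ox Oy; rewrite -[y]opprK; exact/OB/subringN. Qed.

Lemma subring_sum (I : finType) (F : I -> R) :
  (forall i, O (F i)) -> O (\sum_i F i).
Proof. by move=> OF; elim/big_ind: _ => //; [exact: subring0|exact: subringD]. Qed.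

Lemma subring_sign n x : O x -> O ((-1) ^+ n * x).
Proof. by rewrite -signr_odd mulr_sign; case: ifP => // _; exact: subringN. Qed.

Lemma matrices_over1 : matrices_over O 1%:M.
Proof. by move=> i j; rewrite mxE; case: (i == j) => //; exact: subring0. Qed.

Lemma matrices_over_delta k l : matrices_over O (delta_mx k l).
Proof. by move=> i j; rewrite mxE; case: andb => //; exact: subring0. Qed.

Lemma matrices_overD A B :
  matrices_over O A -> matrices_over O B -> matrices_over O (A + B).
Proof. by move=> OA OB' i j; rewrite mxE; exact: subringD. Qed.

Lemma matrices_overB A B :
  matrices_over O A -> matrices_over O B -> matrices_over O (A - B).
Proof. by move=> OA OB' i j; rewrite !mxE; exact: OB. Qed.

Lemma matrices_overM A B :
  matrices_over O A -> matrices_over O B -> matrices_over O (A *m B).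
Proof.
by move=> OA OB' i j; rewrite !mxE; apply: subring_sum => k; exact: OM.
Qed.

End Subring.

Lemma quadratic_field_subring (R : realType) (m : nat) :
  is_subring (quadratic_field R m).
Proof.
split.
- by exists 1, 0; rewrite rmorph1 rmorph0 mul0r addr0.
- move=> _ _ [a [b ->]] [c [d ->]]; exists (a - c), (b - d).
  by rewrite !rmorphB /=; ring.
- move=> _ _ [a [b ->]] [c [d ->]].
  exists (a * c + b * d * m%:R), (a * d + b * c).
  have sq : Num.sqrt m%:R ^+ 2 = m%:R :> R by rewrite sqr_sqrtr ?ler0n.
  rewrite !rmorphD !rmorphM /= rmorph_nat.
  by set s := Num.sqrt _ in sq *; rewrite -sq; ring.
Qed.

Lemma ring_of_integers_subring (R : realType) (m : nat) :
  is_subring (ring_of_integers R m).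
Proof.
have [K1 KB KM] := quadratic_field_subring R m.
split.
- by split=> //; exact: integral1.
- by move=> x y [Kx Ix] [Ky Iy]; split; [exact: KB | exact: integral_sub].
- by move=> x y [Kx Ix] [Ky Iy]; split; [exact: KM | exact: integral_mul].
Qed.

(** * Adjugate, determinant and inverse in size two *)

Lemma adj_mx2 (R : comNzRingType) (M : 'M[R]_2) i j :
  \adj M i j = (-1) ^+ (i + j) * M (rev_ord j) (rev_ord i).
Proof.
(* Deleting the index [k] from ['I_2] leaves only [rev_ord k], so every minor is a single entry. *)
have lift2 (k : 'I_2) : lift k 0 = rev_ord k.
  by apply: val_inj; case: k => [[|[|]]].
by rewrite mxE /cofactor det_mx11 !mxE !lift2 addnC.
Qed.

Lemma det_mx2 (R : comNzRingType) (M : 'M[R]_2) :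
  \det M = M 0 0 * M 1 1 - M 0 1 * M 1 0.
Proof.
have rev0 : rev_ord 0 = 1 :> 'I_2 by exact: val_inj.
have rev1 : rev_ord 1 = 0 :> 'I_2 by exact: val_inj.
have /matrixP/(_ 0 0) := mul_mx_adj M; rewrite !mxE eqxx mulr1n => <-.
rewrite big_ord_recl big_ord1 (_ : lift _ _ = 1); last exact: val_inj.
by rewrite !adj_mx2 rev0 rev1 /= !expr0 expr1 mul1r mulN1r mulrN.
Qed.

Lemma invmx_det1 (R : realType) (M : 'M[R]_2) : \det M = 1 -> invmx M = \adj M.
Proof. by move=> M1; rewrite /invmx unitmxE M1 unitr1 invr1 scale1r. Qed.

(** * The normalizer of [SL2 O] for a subring [O] *)

Definition entry_products_over {R : realType} (O : set R) (M : 'M[R]_2) : Prop :=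
  forall i j k l, O (M i j * M k l).

(** When the determinant is 1, the inverse is the adjugate, whose entries are those of [M] up to
    order and sign. *)
Lemma entry_products_over_invmx {R : realType} {O : set R} (M : 'M[R]_2) :
  is_subring O -> \det M = 1 ->
  entry_products_over O M -> entry_products_over O (invmx M).
Proof.
move=> Oring M1 OM i j k l; rewrite invmx_det1// !adj_mx2 mulrACA -exprD.
exact: subring_sign.
Qed.

(** Each entry of the conjugate is a sum of terms formed by an entry of [A] and, up to sign, a
    product of two entries of [M]. *)
Lemma conj_over {R : realType} {O : set R} (M A : 'M[R]_2) :
  is_subring O -> \det M = 1 -> entry_products_over O M ->
  matrices_over O A -> matrices_over O (invmx M *m A *m M).
Proof.
move=> Oring M1 OM OA i j; have [_ _ Omul] := Oring.
rewrite mxE; apply: subring_sum => // k.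
rewrite mxE mulr_suml; apply: subring_sum => // l.
rewrite mulrAC invmx_det1// adj_mx2 mulrC -mulrA.
by apply: Omul => //; exact: subring_sign.
Qed.

Lemma conj_SL2 {R : realType} {O : set R} (M A : 'M[R]_2) :
  is_subring O -> \det M = 1 -> entry_products_over O M ->
  SL2 O A -> SL2 O (invmx M *m A *m M).
Proof.
move=> Oring M1 OM [OA A1]; split; first exact: conj_over.
by rewrite !det_mulmx det_inv M1 A1 invr1 !mulr1.
Qed.

Lemma SL2_transvection {R : realType} {O : set R} (i j : 'I_2) :
  is_subring O -> i != j -> SL2 O (1%:M + delta_mx i j).
Proof.
move=> Oring nij; split.
  apply: matrices_overD => //; first exact: matrices_over1.
  exact: matrices_over_delta.
rewrite det_mx2 !mxE; case: i j nij => [[|[|]]] // ? [[|[|]]] // ? _ /=.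
- by rewrite !(mulr0n, mulr1n, addr0, mulr1, mulr0, subr0, add0r).
- by rewrite !(mulr0n, mulr1n, addr0, mulr1, mulr0, mul0r, subr0, add0r).
Qed.

(* [Γ] spans the matrix ring: [E_ij] is a transvection minus the identity when
   [i != j], and [E_ii = E_ij E_ji]. *)
Lemma conj_delta_over {R : realType} {O : set R} (M : 'M[R]_2) :
  is_subring O -> \det M = 1 ->
  (forall g, SL2 O g -> matrices_over O (invmx M *m g *m M)) ->
  forall i j, matrices_over O (invmx M *m delta_mx i j *m M).
Proof.
move=> Oring M1 OM.
have Mu : M \in unitmx by rewrite unitmxE M1 unitr1.
have offdiag i j : i != j -> matrices_over O (invmx M *m delta_mx i j *m M).
  move=> nij; have := OM _ (SL2_transvection _ _ Oring nij).
  rewrite mulmxDr mulmxDl mulmx1 mulVmx// => OMij.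
  rewrite -[X in matrices_over _ X](addKr 1%:M) addrC.
  by apply: matrices_overB => //; exact: matrices_over1.
move=> i j; have [<-{j}|/offdiag//] := eqVneq i j.
have nij : i != rev_ord i by case: i => [[|[|]]].
have -> : invmx M *m delta_mx i i *m M =
    (invmx M *m delta_mx i (rev_ord i) *m M) *m
    (invmx M *m delta_mx (rev_ord i) i *m M).
  by rewrite -(mul_delta_mx (rev_ord i)) !mulmxA mulmxK.
by apply: matrices_overM => //; apply: offdiag; rewrite // eq_sym.
Qed.

(** A matrix unit factors through dimension one, so the product is column [j] of [A] times row [k]
    of [B]. *)
Lemma mulmx_delta_mulmx (R : realType) (A B : 'M[R]_2) i j k l :
  (A *m delta_mx j k *m B) i l = A i j * B k l.
Proof.
by rewrite -(mul_delta_mx (0 : 'I_1)) mulmxA -colE -mulmxA -rowE !mxE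
  big_ord1 !mxE.
Qed.

Lemma normalizer_SL2P {R : realType} {O : set R} (M : 'M[R]_2) :
  is_subring O ->
  normalizer (SL2 O) M <-> \det M = 1 /\ entry_products_over O M.
Proof.
move=> Oring; split=> [[[_ M1] NM]|[M1 OM]].
  split=> // i j k l.
  have OM g : SL2 O g -> matrices_over O (invmx M *m g *m M).
    by move=> Og; have [] : SL2 O (invmx M *m g *m M) by rewrite -NM; exists g.
  (* The adjugate transposes and reverses indices; the reversed indices are chosen so that this
     entry is [M i j * M k l] up to sign. *)
  have := conj_delta_over _ Oring M1 OM (rev_ord i) k (rev_ord j) l.
  rewrite mulmx_delta_mulmx invmx_det1// adj_mx2 !rev_ordK -mulrA.
  by move/(subring_sign Oring (rev_ord j + rev_ord i)); rewrite signrMK.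
have Mu : M \in unitmx by rewrite unitmxE M1 unitr1.
split; first by split.
apply/seteqP; split=> [_ [g Og <-]|g Og]; first exact: conj_SL2.
(* For the reverse inclusion, [g] is the conjugate of [M g M^-1], which lies in [SL2 O] because
   [invmx M] also has its entry products in [O]. *)
exists (M *m g *m invmx M).
  rewrite -{1}[M]invmxK; apply: conj_SL2 => //.
    by rewrite det_inv M1 invr1.
  exact: entry_products_over_invmx.
by rewrite -!mulmxA mulVmx// mulmx1 mulmxA mulVmx// mul1mx.
Qed.

(** * Ideals generated by matrix entries, and their squares *)

Lemma ideal_span_ind {R : realType} {O A P : set R} :
  P 0 -> (forall x y, P x -> P y -> P (x + y)) ->
  (forall c a, O c -> A a -> P (c * a)) -> ideal_span O A `<=` P.
Proof.
move=> P0 PD PM _ [n [c [a [Oc Aa ->]]]].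
by elim/big_ind: _ => // i _; exact: PM.
Qed.

Lemma ideal_span_mul {R : realType} {O A : set R} c a :
  O c -> A a -> ideal_span O A (c * a).
Proof.
by move=> Oc Aa; exists 1, (fun=> c), (fun=> a); split=> //; rewrite big_ord1.
Qed.

(** Meant for multiples of a determinant, which is a difference of two products of entries. *)
Lemma ideal_spanB_mul {R : realType} {O A : set R} c a b :
  is_subring O -> O c -> A a -> A b -> ideal_span O A (c * (a - b)).
Proof.
move=> Oring Oc Aa Ab.
exists 2, (fun i => if i == 0 then c else - c), (fun i => if i == 0 then a else b).
split=> [i|i|]; first by case: ifP => // _; exact: subringN.
  by case: ifP.
by rewrite big_ord_recl big_ord1 /= mulNr mulrBr.
Qed.

Lemma entry_ideal_entry {R : realType} {O : set R} (L : 'M[R]_2) i j :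
  is_subring O -> entry_ideal O L (L i j).
Proof.
by move=> [O1 _ _]; rewrite -[L i j]mul1r; apply: ideal_span_mul => //; exists i, j.
Qed.

(* The determinant lies in [I(L)^2], so equality amounts to divisibility of the
   products of two entries. *)
Lemma entry_ideal_sqrP {R : realType} {O : set R} (L : 'M[R]_2) :
  is_subring O ->
  ideal_mul O (entry_ideal O L) (entry_ideal O L) = principal_ideal O (\det L)
  <-> forall i j k l, principal_ideal O (\det L) (L i j * L k l).
Proof.
move=> Oring; have [O1 OB OM] := Oring.
set I := entry_ideal O L; set P := principal_ideal O _.
have IL i j : I (L i j) by exact: entry_ideal_entry.
have II i j k l : [set x * y | x in I & y in I] (L i j * L k l).
  by exists (L i j) => //; exists (L k l).
have P0 : P 0 by exists 0; [exact: subring0|rewrite mul0r].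
have PD x y : P x -> P y -> P (x + y).
  move=> [a Oa <-] [b Ob <-].
  by exists (a + b); [exact: subringD|rewrite mulrDl].
have PM c x : O c -> P x -> P (c * x).
  by move=> Oc [a Oa <-]; exists (c * a); [exact: OM|rewrite mulrA].
split=> [<- i j k l|PL].
  by rewrite -[_ * _]mul1r; exact: ideal_span_mul.
apply/seteqP; split.
  apply: ideal_span_ind => // c _ Oc [x Ix [y Iy <-]]; apply: (PM) => // {c Oc}.
  (* A product [x * y] of elements of [I] is reduced to products of entries in two stages: first [y]
     varies with an entry as left factor, then [x] varies. *)
  have Py k l : P (L k l * y).
    move: y Iy; apply: (@ideal_span_ind _ _ _ [set y | P (L k l * y)]).
    - by rewrite /= mulr0.
    - by move=> y z Py Pz; rewrite /= mulrDr; exact: PD.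
    - by move=> c _ Oc [i [j ->]]; rewrite /= mulrCA; exact: PM.
  move: x Ix; apply: (@ideal_span_ind _ _ _ [set x | P (x * y)]).
  - by rewrite /= mul0r.
  - by move=> x z Px Pz; rewrite /= mulrDl; exact: PD.
  - by move=> c _ Oc [i [j ->]]; rewrite /= -mulrA; exact: PM.
by move=> _ [c Oc <-]; rewrite det_mx2; exact: ideal_spanB_mul.
Qed.

Theorem theorem1 (R : realType) (m : nat) (m_gt1 : (1 < m)%N)
    (m_sqfree : squarefree m) :
  let OK := ring_of_integers R m in
  normalizer (SL2 OK) =
  [set (Num.sqrt (\det L))^-1 *: L | L in
    [set L : 'M[R]_2 | [/\ matrices_over OK L, 0 < \det L &
       ideal_mul OK (entry_ideal OK L) (entry_ideal OK L)
       = principal_ideal OK (\det L)]]].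
Proof.
move=> OK; have Oring : is_subring OK := ring_of_integers_subring R m.
apply/seteqP; split=> [M /(normalizer_SL2P _ Oring)[M1 OM]|].
  have [i [j Mij]] : exists i j, M i j != 0.
    case: (eqVneq (M 0 0) 0) => [M00|]; last by exists 0, 0.
    exists 0, 1; apply: contra_eq_neq M1 => M01.
    by rewrite det_mx2 M00 M01 !mul0r subrr eq_sym oner_neq0.
  have p_gt0 : 0 < `|M i j| by rewrite normr_gt0.
  have det_pM : \det (`|M i j| *: M) = `|M i j| ^+ 2 by rewrite detZ M1 mulr1.
  (* The absolute value matters: the square root of the determinant is [|M i j|], so normalizing
     returns [M] and not [- M]. *)
  exists (`|M i j| *: M) => /=; last first.
    by rewrite det_pM sqrtr_sqr normr_id scalerA mulVf ?scale1r ?gt_eqF.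
  split.
  - move=> k l; rewrite mxE normrEsign -mulrA; exact: subring_sign.
  - by rewrite det_pM exprn_gt0.
  - apply/entry_ideal_sqrP => // k l k' l'; rewrite det_pM !mxE.
    (* Both entries of [L] carry the factor [|M i j|], whose square is the determinant; the cofactor
       is a product of two entries of [M]. *)
    by exists (M k l * M k' l') => //; ring.
move=> _ [L [_ L_gt0 /(entry_ideal_sqrP _ Oring) PL] <-].
have sqrtL : Num.sqrt (\det L) ^- 2 * \det L = 1.
  by rewrite sqr_sqrtr ?mulVf ?gt_eqF// ltW.
apply/normalizer_SL2P => //; split; first by rewrite detZ exprVn.
(* Normalizing divides a product of two entries of [L] by [\det L], which leaves exactly the
   quotient [c] in [OK]. *)
move=> i j k l; rewrite !mxE; have [c Oc cE] := PL i j k l.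
by rewrite mulrACA -cE mulrCA -expr2 exprVn sqrtL mulr1.
Qed.
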